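(* Let $\rho^\star \in \mathbb{R}^{n\times n}$ be an optimal solution of the SDP $\max_{\rho} \operatorname{tr}(C\rho)$ subject to $\rho \succeq 0$, $\rho_{ii} = 1/n$ for all $i\in[n]$, where $C\in\mathbb{R}^{n\times n}$ is a symmetric cost matrix normalized in operator norm, $\|C\|=1$, with the block structure $C = \begin{pmatrix} 0 & B \\ B^T & 0 \end{pmatrix}$ for some $B\in\mathbb{R}^{n/2\times n/2}$. Let $\rho\in \mathbb{R}^{n\times n}$ be a positive semidefinite approximate solution with \[ \operatorname{tr}(C\rho^\star) - \operatorname{tr}(C\rho) \leq \epsilon \quad\text{and}\quad \sum_i \Big|\rho_{ii}-\frac{1}{n}\Big| \leq \epsilon, \] with $0\leq\epsilon\leq 1/2$. Let $x\in \{-1,1\}^{n}$ be the vector obtained by applying the randomized rounding procedure to $\rho$, i.e. compute the symmetric matrix square root $\sqrt{\rho}$, sample $g_j \overset{\mathrm{iid}}{\sim} \mathcal{N}(0,1)$ for $j\in[n]$, and set $x_i = \operatorname{sgn}\big(\sum_j (\sqrt{\rho})_{ij} g_j\big)$ for $i\in[n]$. Then \[ \mathbb{E}[x^T C x] \geq \left(\frac{4}{\pi} - 1\right) n \operatorname{tr}(C \rho^\star) - \mathcal{O}(n\epsilon^{1/3}). \]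
   Context: The expectation is over the Gaussian vector $g$ in the rounding procedure. $\|C\|$ denotes the largest singular value of $C$. *)

(* Defs.v *)
From HB Require Import structures.
From mathcomp Require Import all_boot all_order all_algebra.
From mathcomp Require Import all_classical all_reals all_analysis.
Set Implicit Arguments. Unset Strict Implicit. Unset Printing Implicit Defensive.
Import Order.TTheory GRing.Theory Num.Theory.
Import numFieldNormedType.Exports.
Local Open Scope ring_scope.

Section Defs.
Context {R : realType}.

Definition psd (n : nat) (A : 'M[R]_n) : Prop :=
  A^T = A /\ forall v : 'cV[R]_n, 0 <= (v^T *m A *m v) 0 0.

Definition largest_singular_value (n : nat) (C : 'M[R]_n) (s : R) : Prop :=
  0 <= s /\ eigenvalue (C^T *m C) (s ^+ 2) /\
  forall a : R, eigenvalue (C^T *m C) a -> a <= s ^+ 2.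

Definition sdp_feasible (n : nat) (rho : 'M[R]_n) : Prop :=
  psd rho /\ forall i : 'I_n, rho i i = (n%:R)^-1.

Definition sdp_optimal (n : nat) (C rhostar : 'M[R]_n) : Prop :=
  sdp_feasible rhostar /\
  forall rho : 'M[R]_n, sdp_feasible rho -> \tr (C *m rho) <= \tr (C *m rhostar).

(* sign with the convention sgn 0 = 1, so that the output lies in {-1,1}. *)
Definition sgn1 (t : R) : R := if 0 <= t then 1 else -1.

(* Expectation over g = (g_0,...,g_{n-1}) with g_j iid N(0,1), as the iterated
   integral against the standard normal probability measure (Fubini). *)
Fixpoint gauss_expect (n : nat) : ('cV[R]_n -> R) -> R :=
  match n return ('cV[R]_n -> R) -> R with
  | 0 => fun F => F 0
  | n'.+1 => fun F =>
      \int[normal_prob (0:R) 1]_t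
        gauss_expect (fun v : 'cV[R]_n' => F (col_mx (t%:M : 'cV[R]_1) v))
  end.

(* Rounded vector: x_i = sgn(sum_j S_ij g_j), where S = sqrt(rho). *)
Definition round_vec (n : nat) (S : 'M[R]_n) (g : 'cV[R]_n) : 'cV[R]_n :=
  \col_i sgn1 ((S *m g) i 0).

Definition rounding_value (n : nat) (C S : 'M[R]_n) : R :=
  gauss_expect (fun g => let x := round_vec S g in (x^T *m C *m x) 0 0).

End Defs.

(* Main.v *)
(* For unit vectors u, v and a standard Gaussian vector g,
   E[<u,g> sgn<v,g>] = sqrt(2/pi) <u,v>, so with c = sqrt(pi/2) and
   f_u = <u,g> - c sgn<u,g> Rietz's identity reads
   c^2 E[sgn<u,g> sgn<v,g>] = <u,v> + E[f_u f_v],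
   where E[f_u^2] = pi/2 - 1.  Up to the factor n (pi/2 - 1) the Gram matrix of
   the f_u is feasible for the SDP, and since C is bipartite, changing the sign
   of one block turns the upper bound by the optimum into a lower bound.  When
   the rows of S only approximately have norm n^(-1/2), normalizing them (and
   discarding the zero rows) changes the objective by at most a multiple of
   n (eps / delta + delta) for every delta > 0, because |C| = 1; the choice
   delta = eps^(1/3) suffices.
   The correlation with the sign comes from the fact that u |-> <u,g> sgn<v,g>
   is a subgradient at v of w |-> |<w,g>|, whose expectation sqrt(2/pi) |w| is
   differentiable at v <> 0. *)
Require Import Defs.
From HB Require Import structures.
From mathcomp Require Import all_boot all_order all_algebra.
From mathcomp Require Import all_classical all_reals all_analysis.
From mathcomp Require Import measurable_realfun ring lra.
Set Implicit Arguments.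
Unset Strict Implicit.
Import Order.TTheory GRing.Theory Num.Theory.
Import numFieldNormedType.Exports.
Local Open Scope ring_scope.

(** * Gaussian integrals on the line *)

Section gaussian_line.
Context {R : realType}.
Implicit Types (h : R -> R).
Local Notation mu := (@lebesgue_measure R).
Local Notation gamma := (normal_prob (0 : R) 1).
Local Open Scope classical_set_scope.
Local Open Scope ereal_scope.

(** The Radon-Nikodym derivative of the normal law and [normal_pdf] have the same integral over
    every measurable set, so they agree almost everywhere and can be exchanged under the
    integral. *)
Lemma ge0_integral_normal_prob (m s : R) (f : R -> \bar R) :
  measurable_fun [set: R] f -> (forall x, 0 <= f x) ->
  \int[normal_prob m s]_x f x = \int[mu]_x (f x * (normal_pdf m s x)%:E).
Proof.
move=> mf f0.
have dom := @normal_prob_dominates R m s.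
rewrite -(Radon_Nikodym_SigmaFinite.change_of_variables dom)//.
have iN := Radon_Nikodym_SigmaFinite.f_integrable dom.
apply: ae_eq_integral => //.
- by apply: emeasurable_funM => //; exact: measurable_int iN.
- apply: emeasurable_funM => //; apply/measurable_EFinP.
  exact: measurable_normal_pdf.
- apply: ae_eqe_mul2l => /=; apply: integral_ae_eq => //=.
  + by apply/measurable_EFinP; exact: measurable_normal_pdf.
  + by move=> E _ mE; rewrite -Radon_Nikodym_SigmaFinite.f_integral.
Qed.

Lemma normal_pdf_scale (m s t : R) : (0 < s)%R ->
  normal_pdf m s t = (s^-1 * normal_pdf 0 1 ((t - m) / s))%R.
Proof.
move=> s0; rewrite !normal_pdfE ?oner_eq0 ?gt_eqF// /normal_peak /normal_fun.
rewrite expr1n !mul1r subr0 mulrA; congr (_ * expR _)%R; last first.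
  by field; rewrite gt_eqF.
rewrite -invfM -mulrnAr sqrtrM ?sqr_ge0// sqrtr_sqr gtr0_norm//.
Qed.

Lemma continuous_affine_comp h : continuous h ->
  forall m s : R, continuous (fun t => h (m + s * t))%R.
Proof.
move=> ch m s t; apply: (@continuous_comp R R R (fun t => m + s * t)%R h);
  last exact: ch.
by apply: cvgD; [exact: cvg_cst|apply: cvgM; [exact: cvg_cst|exact: cvg_id]].
Qed.

Lemma integral_normal_affine h (m s : R) : (0 < s)%R ->
  continuous h -> (forall x, 0 <= h x)%R ->
  \int[gamma]_t (h (m + s * t)%R)%:E = \int[mu]_y (h y * normal_pdf m s y)%:E.
Proof.
move=> s0 ch h0.
have sN0 : s != 0%R by rewrite gt_eqF.
have ch' : continuous (fun t => h (m + s * t))%R by exact: continuous_affine_comp.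
rewrite ge0_integral_normal_prob//; last 2 first.
- by apply/measurable_EFinP; exact: continuous_measurable_fun.
- by move=> x; rewrite lee_fin.
(* The substitution uses the inverse affine map; its derivative [s^-1] is the factor in
   [normal_pdf_scale]. *)
pose F (y : R^o) : R^o := ((y - m) / s)%R.
have F' : F^`()%classic = cst (s^-1)%R.
  apply/funext => x; rewrite /F derive1E deriveM// deriveD// derive_cst scaler0.
  by rewrite add0r derive_id derive_cst addr0 scaler1.
under eq_integral do rewrite -EFinM.
rewrite (@increasing_ge0_integration_by_substitutionT R F
  (fun t => h (m + s * t) * normal_pdf 0 1 t)%R)//.
- apply: eq_integral => y _; rewrite F' (normal_pdf_scale _ _ s0).
  rewrite [X in X%:E](_ : _ =
    h (m + s * ((y - m) / s)) * normal_pdf 0 1 ((y - m) / s) * s^-1)%R//.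
  have -> : (m + s * ((y - m) / s) = y)%R by field.
  by congr (_%:E); rewrite mulrAC mulrA.
- by move=> x y xy; rewrite /F ltr_pM2r ?invr_gt0// ltrD2r.
- by rewrite F' => ?; exact: cvg_cst.
- by rewrite F'; exact: is_cvg_cst.
- by rewrite F'; exact: is_cvg_cst.
- by apply/gt0_cvgMlNy; [rewrite invr_gt0|exact: cvg_addrr_Ny].
- by apply/gt0_cvgMly; [rewrite invr_gt0|exact: cvg_addrr].
- move=> x; apply: cvgM; first exact: ch'.
  by apply: continuous_normal_pdf; rewrite oner_eq0.
- by move=> x; rewrite mulr_ge0 ?normal_pdf_ge0.
Qed.

Lemma integral_normalN h : continuous h -> (forall x, 0 <= h x)%R ->
  \int[gamma]_t (h (- t)%R)%:E = \int[gamma]_t (h t)%:E.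
Proof.
move=> ch h0.
have mh : measurable_fun setT (EFin \o h).
  by apply/measurable_EFinP; exact: continuous_measurable_fun.
have mhN : measurable_fun setT (fun t : R => (h (- t)%R)%:E).
  by apply: (@measurableT_comp _ _ _ _ _ _ (EFin \o h) _ (-%R : R -> R)).
have mp : measurable_fun setT (fun t : R => (normal_pdf 0 1 t)%:E).
  by apply/measurable_EFinP; exact: measurable_normal_pdf.
rewrite !ge0_integral_normal_prob//; try by move=> x; rewrite lee_fin.
pose f (t : R) := (h t)%:E * (normal_pdf 0 1 t)%:E.
have f0 t : 0 <= f t by rewrite mule_ge0// lee_fin// normal_pdf_ge0.
have mf : measurable_fun setT f by exact: emeasurable_funM.
transitivity (\int[mu]_t f (- t)%R).
  apply: eq_integral => t _; congr (_ * _%:E).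
  by rewrite !normal_pdfE ?oner_eq0// /normal_fun !subr0 sqrrN.
transitivity (\int[pushforward mu (-%R : R -> measurableTypeR R)]_t f t).
  by rewrite ge0_integral_pushforward.
by apply: eq_measure_integral => A mA _; exact: lebesgue_measureN.
Qed.

(** Symmetry of the normal law; it reduces the convolution below to a nonnegative second
    coefficient. *)
Lemma integral_normal_abs h : continuous h -> (forall x, 0 <= h x)%R ->
  forall a : R, \int[gamma]_t (h (a * t)%R)%:E = \int[gamma]_t (h (`|a| * t)%R)%:E.
Proof.
move=> ch h0 a.
have ch' : continuous (fun t => h (a * t))%R.
  by have := @continuous_affine_comp h ch 0%R a;
     under [X in continuous X]eq_fun do rewrite add0r.
have [_|_] := ger0P a => //.
rewrite -(integral_normalN ch')//.
by apply: eq_integral => t _; rewrite mulrN mulNr.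
Qed.

(* Completing the square in t; this is the density identity behind the stability
   of Gaussians under convolution. *)
Lemma normal_pdf_completion (a b t y : R) : (0 < b)%R ->
  let c := Num.sqrt (a ^+ 2 + b ^+ 2) in
  (normal_pdf (a * t) b y * normal_pdf 0 1 t =
   normal_pdf 0 c y * normal_pdf (a * y / c ^+ 2) (b / c) t)%R.
Proof.
move=> b0 c.
have b20 : (0 < b ^+ 2)%R by rewrite exprn_gt0.
have c20 : (0 < a ^+ 2 + b ^+ 2)%R by rewrite ltr_wpDl ?sqr_ge0.
have c0 : (0 < c)%R by rewrite sqrtr_gt0.
have cE : (c ^+ 2 = a ^+ 2 + b ^+ 2)%R by rewrite sqr_sqrtr// ltW.
have bc0 : (0 < b / c)%R by rewrite divr_gt0.
rewrite (normal_pdf_scale _ _ b0) (normal_pdf_scale _ _ c0) (normal_pdf_scale _ _ bc0).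
rewrite !normal_pdfE ?oner_eq0// /normal_fun.
set p := normal_peak 1.
have -> : (b^-1 * (p * expR (- ((y - a * t) / b - 0) ^+ 2 / (1 ^+ 2 *+ 2))) *
   (p * expR (- (t - 0) ^+ 2 / (1 ^+ 2 *+ 2))) = b^-1 * p ^+ 2 *
   expR (- ((y - a * t) / b - 0) ^+ 2 / (1 ^+ 2 *+ 2) +
   - (t - 0) ^+ 2 / (1 ^+ 2 *+ 2)))%R by rewrite expRD; ring.
set u := expR _; set v := expR _; set w := expR _.
have -> : (c^-1 * (p * v) * ((b / c)^-1 * (p * w)) = b^-1 * p ^+ 2 * (v * w))%R.
  by field; rewrite !gt_eqF.
rewrite /v /w -expRD /u; congr (_ * expR _)%R.
have c2N0 : (a ^+ 2 + b ^+ 2)%R != 0%R by rewrite gt_eqF.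
apply/eqP; rewrite -subr_eq0; apply/eqP.
set L := (LHS).
have -> : L = (- ((y - a * t) ^+ 2 / b ^+ 2 + t ^+ 2 - y ^+ 2 / c ^+ 2 -
    (t - a * y / c ^+ 2) ^+ 2 * c ^+ 2 / b ^+ 2) / 2)%R.
  rewrite /L; field; rewrite !gt_eqF//.
rewrite cE; field.
by rewrite c2N0 gt_eqF.
Qed.

(** The inner integral becomes one against the density of mean [a * t] and deviation [b]. After
    Tonelli, [normal_pdf_completion] splits off a probability density in [t], which integrates to
    1. *)
Lemma normal_convolution h (a b : R) : continuous h -> (forall x, 0 <= h x)%R ->
  \int[gamma]_t \int[gamma]_s (h (a * t + b * s)%R)%:E =
  \int[gamma]_t (h (Num.sqrt (a ^+ 2 + b ^+ 2) * t)%R)%:E.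
Proof.
move=> ch h0.
have -> : \int[gamma]_t \int[gamma]_s (h (a * t + b * s)%R)%:E =
    \int[gamma]_t \int[gamma]_s (h (a * t + `|b| * s)%R)%:E.
  apply: eq_integral => t _.
  apply: (integral_normal_abs (h := fun x => h (a * t + x)%R)) => //.
  by have := @continuous_affine_comp h ch (a * t)%R 1%R;
     under [X in continuous X]eq_fun do rewrite mul1r.
rewrite -(real_normK (num_real b)).
(* The density argument needs a positive deviation, so [b = 0] is treated apart: the inner integrand
   is then constant. *)
have [->|b0] := eqVneq b 0%R.
  rewrite normr0 expr0n/= addr0 sqrtr_sqr -integral_normal_abs//.
  apply: eq_integral => t _; under eq_integral do rewrite mul0r addr0.
  by rewrite integral_cst//= [X in _ * X]probability_setT mule1.
have {b0} : (0 < `|b|)%R by rewrite normr_gt0.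
move: `|b|%R => {}b b0.
set c := Num.sqrt _.
have c0 : (0 < c)%R by rewrite sqrtr_gt0 ltr_wpDl ?sqr_ge0 ?exprn_gt0.
have bc0 : (0 < b / c)%R by rewrite divr_gt0.
under eq_integral do rewrite integral_normal_affine//.
pose f (z : R * R) := (h z.2 * normal_pdf (a * z.1) b z.2)%:E.
have f0 z : 0 <= f z by rewrite lee_fin mulr_ge0// normal_pdf_ge0.
have mf : measurable_fun [set: R * R] f.
  apply/measurable_EFinP; apply: measurable_funM.
    by apply: measurableT_comp => //; exact: continuous_measurable_fun.
  under eq_fun do rewrite normal_pdfE ?gt_eqF//.
  apply: measurable_funM => //; apply: measurableT_comp => //=.
  apply: measurable_funM => //; apply: measurableT_comp => //=.
  apply: measurable_funX; apply: measurable_funB => //.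
  exact: measurable_funM.
rewrite (ge0_integral_normal_prob _ _ (f := fun t => \int[mu]_y f (t, y)))//; last 2 first.
- exact: measurable_fun_fubini_tonelli_F.
- by move=> x; exact: integral_ge0.
pose g (z : R * R) := f z * (normal_pdf 0 1 z.1)%:E.
have g0 z : 0 <= g z by rewrite mule_ge0// lee_fin normal_pdf_ge0.
have mg : measurable_fun [set: R * R] g.
  apply: emeasurable_funM => //; apply/measurable_EFinP.
  by apply: measurableT_comp => //; exact: measurable_normal_pdf.
transitivity (\int[mu]_t \int[mu]_y g (t, y)).
  apply: eq_integral => t _; rewrite -ge0_integralZr//.
  - by apply: (measurableT_comp mf); exact: pair1_measurable.
  - by rewrite lee_fin normal_pdf_ge0.
rewrite fubini_tonelli//.
transitivity (\int[mu]_y (h y * normal_pdf 0 c y)%:E); last first.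
  by rewrite -integral_normal_affine//; apply: eq_integral => t _; rewrite add0r.
apply: eq_integral => y _.
transitivity (\int[mu]_t ((h y * normal_pdf 0 c y)%:E *
    (normal_pdf (a * y / c ^+ 2) (b / c) t)%:E)).
  apply: eq_integral => t _; rewrite /g /f/= -!EFinM; congr (_%:E).
  by rewrite -[LHS]mulrA normal_pdf_completion// mulrA.
rewrite ge0_integralZl//; first by rewrite integral_normal_pdf mule1.
- by apply/measurable_EFinP; exact: measurable_normal_pdf.
- by move=> t _; rewrite lee_fin normal_pdf_ge0.
- by rewrite lee_fin mulr_ge0// normal_pdf_ge0.
Qed.

Lemma normal_pdf01E (t : R) :
  normal_pdf 0 1 t = ((Num.sqrt (2 * pi))^-1 * expR (- (t ^+ 2 / 2)))%R.
Proof.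
rewrite normal_pdfE ?oner_eq0// /normal_peak /normal_fun expr1n mul1r subr0 mulNr.
by rewrite -[(pi *+ 2)%R]mulr_natl.
Qed.

(** By evenness the integral is twice that over the half line, where minus the density is an
    antiderivative of the integrand. *)
Lemma integral_normal_norm : \int[gamma]_t `|t|%:E = (Num.sqrt (2 / pi))%:E.
Proof.
have pi0 : (0 < pi :> R)%R by exact: pi_gt0.
rewrite (ge0_integral_normal_prob _ _ (f := fun t : R => `|t|%:E))//; last first.
  by apply/measurable_EFinP; exact: normr_measurable.
pose p := (Num.sqrt (2 * pi : R))^-1%R.
pose f (t : R) := (`|t| * normal_pdf 0 1 t)%R.
have cp := @continuous_normal_pdf R 0 1 (oner_neq0 _).
have cf : continuous f.
  by move=> t; apply: cvgM; [exact: norm_continuous|exact: cp].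
rewrite [LHS](_ : _ = \int[mu]_t (f t)%:E)//.
rewrite ge0_symfun_integralT//; last 2 first.
- by move=> x; rewrite /f mulr_ge0// normal_pdf_ge0.
- by move=> x; rewrite /f /= normrN !normal_pdf01E sqrrN.
have dF (x : R) : is_derive x 1%R (fun t : R => - (p * expR (- (t ^+ 2 / 2))))%R
    (x * (p * expR (- (x ^+ 2 / 2))))%R.
  apply: is_derive_eq; rewrite !scaler0 /GRing.scale/=.
  by field.
have cF : continuous (fun t : R => - (p * expR (- (t ^+ 2 / 2))))%R.
  by move=> x; apply/differentiable_continuous/derivable1_diffP; exact: ex_derive.
rewrite -set_itvcy (@ge0_continuous_FTC2y _ f
  (fun t => - (p * expR (- (t ^+ 2 / 2))))%R 0%R 0%R).
- rewrite expr0n/= mul0r oppr0 expR0 mulr1 opprK -EFinD -EFinM add0r.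
  congr (_%:E); rewrite /p.
  rewrite -[LHS]ger0_norm ?mulr_ge0 ?invr_ge0 ?sqrtr_ge0// -sqrtr_sqr exprMn exprVn.
  rewrite sqr_sqrtr ?mulr_ge0 ?(ltW pi0)//; congr Num.sqrt.
  by move: (pi : R) pi0 => a a0; field; rewrite gt_eqF.
- by move=> x _; rewrite /f mulr_ge0// normal_pdf_ge0.
- exact: continuous_subspaceT.
- rewrite -[X in _ --> X]oppr0 -[X in (- X)%R](mulr0 p).
  apply: cvgN; apply: cvgM; first exact: cvg_cst.
  apply: (cvg_comp (fun x => x ^+ 2 / 2)%R (fun x => expR (- x))); last exact: cvgr_expR.
  by apply: gt0_cvgMly => //; exact: cvgr_expr2.
- by move=> x _; exact: ex_derive.
- by apply: cvg_at_right_filter; exact: cF.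
- move=> x; rewrite in_itv/= andbT => x0; rewrite derive1E derive_val.
  by rewrite /f gtr0_norm// normal_pdf01E.
Qed.

(** Multiplied by the standard density, the integrand is [s] times the centered density of deviation
    [s], where [s ^+ 2 = (1 + k)^-1]. *)
Lemma integral_normal_expR (k : R) : (-1 < k)%R ->
  \int[gamma]_t (expR (- (k * t ^+ 2 / 2)))%:E = ((Num.sqrt (1 + k))^-1)%:E.
Proof.
move=> k1; have k0 : (0 < 1 + k)%R by lra.
pose s := ((Num.sqrt (1 + k))^-1)%R.
have s0 : (0 < s)%R by rewrite invr_gt0 sqrtr_gt0.
have s2 : (s ^+ 2 = (1 + k)^-1)%R by rewrite /s exprVn sqr_sqrtr// ltW.
rewrite (ge0_integral_normal_prob _ _
  (f := fun t : R => (expR (- (k * t ^+ 2 / 2)))%:E))//; last first.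
  apply/measurable_EFinP; apply: measurableT_comp => //.
  apply: measurableT_comp => //; apply: measurable_funM => //.
  by apply: measurable_funM => //; exact: measurable_funX.
transitivity (\int[mu]_t (s%:E * (normal_pdf 0 s t)%:E)).
  apply: eq_integral => t _; rewrite -!EFinM (normal_pdf_scale _ _ s0); congr (_%:E).
  rewrite !normal_pdf01E [LHS]mulrCA [RHS]mulrA mulfV ?gt_eqF// mul1r; congr (_ * _)%R.
  rewrite -expRD; congr expR; rewrite subr0 expr_div_n s2; field.
  by rewrite gt_eqF.
rewrite ge0_integralZl//; first by rewrite integral_normal_pdf mule1.
- by apply/measurable_EFinP; exact: measurable_normal_pdf.
- by move=> t _; rewrite lee_fin normal_pdf_ge0.
- by rewrite lee_fin ltW.
Qed.

(* Pins down q as the second moment of a standard Gaussian: the hypothesis says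
   that 1 - k q / 2 is a tangent at 0 to E[exp(- k t^2 / 2)]. *)
Lemma inv_sqrt_tangent (q : R) : (0 <= q)%R ->
  (forall k, -1 < k -> 1 - k * q / 2 <= (Num.sqrt (1 + k))^-1)%R -> q = 1%R.
Proof.
move=> q0 H.
(* Substituting [k = s ^+ 2 - 1] removes the square root. *)
have K (s : R) : (0 < s -> s - 1 <= (s ^+ 2 - 1) * s * q / 2)%R.
  move=> s0; have := H (s ^+ 2 - 1)%R.
  rewrite subrKC sqrtr_sqr gtr0_norm// -[X in (_ <= X)%R]mul1r.
  rewrite ler_pdivlMr//.
  have s20 : (-1 < s ^+ 2 - 1)%R by have : (0 < s ^+ 2)%R; [rewrite exprn_gt0|lra].
  by move=> /(_ s20); lra.
have [q1|q1|//] := ltrgtP q 1%R.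
(* At [s = 1 + d], dividing by [d] leaves [1 <= (2 + 3 * d + d ^+ 2) * q / 2], which fails for
   [q = 1 - 4 * d]. *)
- pose d := ((1 - q) / 4)%R.
  have d0 : (0 < d)%R by rewrite /d; lra.
  have := K (1 + d)%R; rewrite (_ : (1 + d - 1 = d)%R); last by ring.
  rewrite (_ : ((1 + d) ^+ 2 - 1) * (1 + d) * q / 2 =
    d * ((2 + 3 * d + d ^+ 2) * q / 2))%R; last by field.
  rewrite ler_pMr//; move=> /(_ ltac:(lra)) h.
  have qE : (q = 1 - 4 * d)%R by rewrite /d; field.
  have : (q * d ^+ 2 <= q * d)%R.
    by rewrite ler_wpM2l// expr2 ler_piMl ?ltW//; lra.
  nra.
(* At [s = 1 - d] one gets [(2 - 3 * d + d ^+ 2) * q / 2 <= 1], but the left side is at least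
   [q - 3 * d * q / 2 = (q + 1) / 2], which exceeds 1. *)
- pose d := ((q - 1) / (3 * q))%R.
  have q0' : (0 < q)%R by lra.
  have d0 : (0 < d)%R by rewrite /d divr_gt0; lra.
  have dq : (d * q = (q - 1) / 3)%R by rewrite /d; field; lra.
  have d1 : (d < 1)%R by nra.
  have := K (1 - d)%R; rewrite (_ : (1 - d - 1 = - d)%R); last by ring.
  rewrite (_ : ((1 - d) ^+ 2 - 1) * (1 - d) * q / 2 =
    - (d * ((2 - 3 * d + d ^+ 2) * q / 2)))%R; last by field.
  rewrite lerN2 ger_pMr//; move=> /(_ ltac:(lra)) h.
  have : (0 <= d ^+ 2 * q)%R by rewrite mulr_ge0// sqr_ge0.
  nra.
Qed.

(** Integrating [1 - k / 2 * t ^+ 2 <= expR (- (k * t ^+ 2 / 2))] for every [k > -1] gives the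
    hypothesis of [inv_sqrt_tangent]; no integration by parts is involved. *)
Lemma integral_normal_sqr : \int[gamma]_t (t ^+ 2)%:E = 1%:E.
Proof.
have mexp k : measurable_fun setT (fun t : R => (expR (- (k * t ^+ 2 / 2)))%:E).
  apply/measurable_EFinP; apply: measurableT_comp => //.
  apply: measurableT_comp => //; apply: measurable_funM => //.
  by apply: measurable_funM => //; exact: measurable_funX.
have msqr : measurable_fun setT (fun t : R => (t ^+ 2)%:E).
  by apply/measurable_EFinP; exact: measurable_funX.
have iexp k : (-1 < k)%R ->
    gamma.-integrable setT (fun t : R => (expR (- (k * t ^+ 2 / 2)))%:E).
  move=> k1; apply/integrableP; split; first exact: mexp.
  under eq_integral do rewrite gee0_abs ?lee_fin ?expR_ge0//.
  by rewrite integral_normal_expR// ltry.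
have isqr : gamma.-integrable setT (fun t : R => (t ^+ 2)%:E).
  (* Domination with [k = - 2^-1]: [t ^+ 2 <= 4 * expR (t ^+ 2 / 4)]. *)
  have i4 := integrableZl measurableT 4 (iexp (- 2^-1)%R ltac:(lra)).
  apply: le_integrable i4 => // t _.
  rewrite -EFinM !abse_EFin lee_fin !ger0_norm ?sqr_ge0 ?mulr_ge0 ?expR_ge0//.
  have := expR_ge1Dx (- (- 2^-1 * t ^+ 2 / 2))%R.
  by lra.
pose q : R := fine (\int[gamma]_t (t ^+ 2)%:E).
have qE : \int[gamma]_t (t ^+ 2)%:E = q%:E.
  by rewrite /q fineK//; exact: integrable_fin_num.
rewrite qE; congr (_%:E); apply: inv_sqrt_tangent.
  by apply: fine_ge0; apply: integral_ge0 => t _; rewrite lee_fin sqr_ge0.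
move=> k k1; rewrite -lee_fin -integral_normal_expR//.
have -> : ((1 - k * q / 2)%:E = \int[gamma]_t (1 - (k / 2) * t ^+ 2)%:E).
  under eq_integral do rewrite EFinB EFinM.
  rewrite integralB//; last by apply: integrableZl.
  - rewrite integralZl// qE integral_cst//= [X in _ * X]probability_setT mule1.
    by rewrite mulrAC.
  - exact: finite_measure_integrable_cst.
apply: le_integral => //.
- under [X in integrable _ _ X]eq_fun do rewrite EFinB EFinM.
  apply: integrableB => //; last by apply: integrableZl.
  exact: finite_measure_integrable_cst.
- exact: iexp.
- move=> t _; rewrite lee_fin.
  have := expR_ge1Dx (- (k * t ^+ 2 / 2))%R.
  by lra.
Qed.

End gaussian_line.

(** * Gaussian vectors *)

Section dotc_theory.
Context {R : realType}.

Definition dotc n (u v : 'cV[R]_n) : R := \sum_i u i 0 * v i 0.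

Lemma dotcC n (u v : 'cV[R]_n) : dotc u v = dotc v u.
Proof. by apply: eq_bigr => i _; rewrite mulrC. Qed.

Lemma dotc0l n (v : 'cV[R]_n) : dotc 0 v = 0.
Proof. by rewrite /dotc big1// => i _; rewrite mxE mul0r. Qed.

Lemma dotcDl n (u v w : 'cV[R]_n) : dotc (u + v) w = dotc u w + dotc v w.
Proof. by rewrite -big_split; apply: eq_bigr => i _; rewrite mxE mulrDl. Qed.

Lemma dotcZl n a (u w : 'cV[R]_n) : dotc (a *: u) w = a * dotc u w.
Proof. by rewrite mulr_sumr; apply: eq_bigr => i _; rewrite mxE mulrA. Qed.

Lemma dotcDr n (u v w : 'cV[R]_n) : dotc w (u + v) = dotc w u + dotc w v.
Proof. by rewrite dotcC dotcDl !(dotcC w). Qed.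

Lemma dotcZr n a (u w : 'cV[R]_n) : dotc w (a *: u) = a * dotc w u.
Proof. by rewrite dotcC dotcZl dotcC. Qed.

Lemma dotc_ge0 n (u : 'cV[R]_n) : 0 <= dotc u u.
Proof. by apply: sumr_ge0 => i _; rewrite -expr2 sqr_ge0. Qed.

Lemma dotc_eq0 n (u : 'cV[R]_n) : (dotc u u == 0) = (u == 0).
Proof.
apply/eqP/eqP => [|->]; last by rewrite /dotc big1// => i _; rewrite mxE mul0r.
move=> /psumr_eq0P u0; apply/colP => i; rewrite mxE.
have /eqP := u0 (fun i _ => sqr_ge0 (u i 0)) i isT.
by rewrite mulf_eq0 orbb => /eqP.
Qed.

Lemma dotcE n (u v : 'cV[R]_n) : (u^T *m v) 0 0 = dotc u v.
Proof. by rewrite mxE; apply: eq_bigr => i _; rewrite mxE. Qed.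

Lemma dotc_mulmx n (A : 'M[R]_n) u v : dotc u (A *m v) = dotc (A^T *m u) v.
Proof. by rewrite -!dotcE trmx_mul trmxK -mulmxA. Qed.

Lemma quad_dotc n (A : 'M[R]_n) (x : 'cV[R]_n) :
  (x^T *m A *m x) 0 0 = dotc x (A *m x).
Proof. by rewrite -mulmxA dotcE. Qed.

Lemma quad_sum n (A : 'M[R]_n) (x : 'cV[R]_n) :
  (x^T *m A *m x) 0 0 = \sum_i \sum_j A i j * (x i 0 * x j 0).
Proof.
rewrite quad_dotc; apply: eq_bigr => i _; rewrite mxE mulr_sumr.
by apply: eq_bigr => j _; rewrite mulrCA.
Qed.

Lemma dotc_col_mx n (a b : R) (u v : 'cV[R]_n) :
  dotc (col_mx (a%:M : 'cV_1) u) (col_mx (b%:M : 'cV_1) v) = a * b + dotc u v.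
Proof.
rewrite /dotc big_split_ord /= big_ord1 !col_mxEu !mxE !mulr1n; congr (_ + _).
by apply: eq_bigr => i _; rewrite !col_mxEd.
Qed.

End dotc_theory.

(** * Realizing the iterated Gaussian expectation on one probability space *)

Section gaussian_vector.
Context {R : realType}.
Local Open Scope classical_set_scope.
Local Notation gamma := (normal_prob (0 : R) 1).

Definition coord_measurable d (T : measurableType d) n (G : T -> 'cV[R]_n) :=
  forall i, measurable_fun setT (fun x => G x i 0).

(* Borel measurability, tested on measurable families of vectors so that no
   sigma-algebra on 'cV[R]_n is needed. *)
Definition borel_fun n (F : 'cV[R]_n -> R) :=
  forall d (T : measurableType d) (G : T -> 'cV[R]_n),
    coord_measurable G -> measurable_fun setT (F \o G).

Lemma measurable_dotc d (T : measurableType d) n (G : T -> 'cV[R]_n) u :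
  coord_measurable G -> measurable_fun setT (fun x => dotc u (G x)).
Proof. by move=> mG; apply: measurable_sum => i; exact: measurable_funM. Qed.

Lemma coord_measurable_col_mx d (T : measurableType d) n (f : T -> R)
    (G : T -> 'cV[R]_n) : measurable_fun setT f -> coord_measurable G ->
  coord_measurable (fun x => col_mx ((f x)%:M : 'cV_1) (G x)).
Proof.
move=> mf mG i; case: (split_ordP i) => j ->.
  by under eq_fun do rewrite col_mxEu mxE !ord1 mulr1n.
by under eq_fun do rewrite col_mxEd; exact: mG.
Qed.

Lemma bounded_integrable_probability d (T : measurableType d)
    (P : probability T R) (f : T -> R) (M : R) :
  measurable_fun setT f -> (forall x, `|f x| <= M) ->
  P.-integrable setT (EFin \o f).
Proof.
move=> mf fM; apply: measurable_bounded_integrable => //.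
  by rewrite [X in (X < _)%E]probability_setT ltry.
exists M; split; first exact: num_real.
by move=> x Mx y _ /=; exact: le_trans (fM y) (ltW Mx).
Qed.

(** Induction step for [gauss_expectE]: one more independent normal factor is adjoined to the sample
    space, and Fubini applies since [F] is bounded. *)
Lemma gauss_expect_product d (T : measurableType d) (P : probability T R) n
    (G : T -> 'cV[R]_n) (F : 'cV[R]_(1 + n) -> R) (M : R) :
  coord_measurable G -> borel_fun F -> (forall v, `|F v| <= M) ->
  (forall F' : 'cV[R]_n -> R, borel_fun F' -> (forall v, `|F' v| <= M) ->
    gauss_expect F' = \int[P]_x F' (G x)) ->
  @gauss_expect R n.+1 F =
    \int[(gamma \x P)%E]_x F (col_mx (x.1%:M : 'cV_1) (G x.2)).
Proof.
move=> mG bF FM IH /=.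
pose f (x : measurableTypeR R * T) := F (col_mx (x.1%:M : 'cV_1) (G x.2)).
have mf : measurable_fun setT f.
  apply: bF; apply: coord_measurable_col_mx => // i.
  by apply: (measurableT_comp (mG i)).
have intf : (gamma \x P)%E.-integrable setT (EFin \o f).
  by apply: (@bounded_integrable_probability _ _ _ _ M) => // x; exact: FM.
rewrite /Rintegral -(integral12_prod_meas1 intf); congr fine.
apply: eq_integral => t _; rewrite IH//.
  rewrite /Rintegral /fubini_F fineK//; apply: integrable_fin_num => //.
  apply: (@bounded_integrable_probability _ _ _ _ M) => //.
  apply: (bF _ _ (fun x => col_mx (t%:M : 'cV_1) (G x))).
  exact: coord_measurable_col_mx.
move=> d' T' G' mG'; apply: (bF _ _ (fun x => col_mx (t%:M : 'cV_1) (G' x))).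
exact: coord_measurable_col_mx.
Qed.

(** Replaces the iterated integral by an expectation over a random vector [G], so that linearity and
    monotonicity of one integral are at hand. The last clause gives the law of each projection of
    [G], tested on nonnegative continuous functions only; this suffices for squares and absolute
    values. *)
Lemma gauss_expectE n :
  exists (d : measure_display) (T : measurableType d) (P : probability T R)
    (G : T -> 'cV[R]_n),
  [/\ coord_measurable G,
    forall (F : 'cV[R]_n -> R) M, borel_fun F -> (forall v, `|F v| <= M) ->
      gauss_expect F = \int[P]_x F (G x) &
    forall (h : R -> R) v, continuous h -> (forall x, 0 <= h x) ->
      (\int[P]_x (h (dotc v (G x)))%:E =
       \int[gamma]_t (h (Num.sqrt (dotc v v) * t))%:E)%E].
Proof.
elim: n => [|n [d [T [P [G [mG EG lawG]]]]]].
  exists _, unit, (dirac tt), (fun=> 0); split => [[]//|F M _ _|h v ch h0].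
    by rewrite /Rintegral integral_dirac//= indicT mul1r.
  have d0 (w : 'cV[R]_0) : dotc v w = 0 by rewrite /dotc big_ord0.
  rewrite integral_dirac//= diracT mul1e !d0 sqrtr0.
  under eq_integral do rewrite mul0r.
  by rewrite integral_cst//= [X in (_ * X)%E]probability_setT mule1.
exists _, (measurableTypeR R * T)%type, (gamma \x P)%E,
  (fun x => col_mx (x.1%:M : 'cV_1) (G x.2)); split.
- apply: coord_measurable_col_mx => // i.
  by apply: (measurableT_comp (mG i)).
- move=> F M bF FM; apply: (@gauss_expect_product _ _ _ _ _ _ M) => //.
  by move=> F' bF' F'M; exact: (EG F' M).
- move=> h v ch h0.
  pose a := v 0 0; pose w : 'cV[R]_n := dsubmx (v : 'cV_(1 + n)).
  have uE : usubmx (v : 'cV_(1 + n)) = a%:M.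
    apply/colP => i; rewrite !mxE !ord1 mulr1n; congr (v _ _); exact/val_inj.
  have vE : v = col_mx (a%:M : 'cV_1) w.
    by rewrite -uE; exact/esym/(@vsubmxK _ 1 n).
  rewrite vE dotc_col_mx fubini_tonelli1//=; last 2 first.
  + apply/measurable_EFinP; apply: (measurableT_comp (f := h)).
      exact: continuous_measurable_fun.
    apply: measurable_dotc; apply: coord_measurable_col_mx => // i.
    by apply: (measurableT_comp (mG i)).
  + by move=> x; rewrite lee_fin.
  (* Puts the claim in the form of [normal_convolution], with the norm of [w] as second
     coefficient. *)
  rewrite -expr2 -[X in a ^+ 2 + X]sqr_sqrtr; last first.
    by apply: sumr_ge0 => i _; rewrite -expr2 sqr_ge0.
  rewrite -normal_convolution//; apply: eq_integral => t _.
  rewrite /fubini_F /=.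
  under eq_integral do rewrite dotc_col_mx.
  rewrite (lawG (fun x => h (a * t + x)))//.
  by have := @continuous_affine_comp R h ch (a * t) 1;
     under [X in continuous X]eq_fun do rewrite mul1r.
Qed.

End gaussian_vector.

(** * Square-integrable random variables and their bilinear forms *)

Section square_integrable.
Context d (T : measurableType d) (R : realType) (P : probability T R).
Implicit Types f g : T -> R.
Local Open Scope classical_set_scope.

Definition square_integrable f :=
  measurable_fun setT f /\ P.-integrable setT (fun x => (f x ^+ 2)%:E).

Lemma integrable_mul f g : square_integrable f -> square_integrable g ->
  P.-integrable setT (fun x => (f x * g x)%:E).
Proof.
move=> [mf i_f] [mg ig]; apply: le_integrable (integrableD measurableT i_f ig) => //.
  by apply/measurable_EFinP; exact: measurable_funM.
move=> x _; rewrite -EFinD !abse_EFin lee_fin [leRHS]ger0_norm ?addr_ge0 ?sqr_ge0//.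
rewrite normrM -[f x ^+ 2]real_normK ?num_real// -[g x ^+ 2]real_normK ?num_real//.
have := sqr_ge0 (`|f x| - `|g x|); have := sqr_ge0 (`|f x| + `|g x|); nra.
Qed.

Lemma square_integrable_bounded f (M : R) : measurable_fun setT f ->
  (forall x, `|f x| <= M) -> square_integrable f.
Proof.
move=> mf fM; split=> //.
apply: (@bounded_integrable_probability _ _ _ _ (fun x => f x ^+ 2) (M ^+ 2)).
  exact: measurable_funX.
by move=> x; rewrite normrX lerXn2r// nnegrE (le_trans _ (fM x)).
Qed.

Lemma square_integrableZ a f : square_integrable f ->
  square_integrable (fun x => a * f x).
Proof.
move=> [mf i_f]; split; first exact: measurable_funM.
by under eq_fun do rewrite exprMn EFinM; exact: integrableZl.
Qed.

Lemma square_integrableD f g : square_integrable f -> square_integrable g ->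
  square_integrable (fun x => f x + g x).
Proof.
move=> sf sg; split; first by apply: measurable_funD; [case: sf|case: sg].
have := integrableD measurableT (integrableD measurableT sf.2 sg.2)
  (integrableZl measurableT 2 (integrable_mul sf sg)).
apply: eq_integrable => // x _; rewrite -EFinM -!EFinD; congr (_%:E); ring.
Qed.

Lemma square_integrableB f g : square_integrable f -> square_integrable g ->
  square_integrable (fun x => f x - g x).
Proof.
move=> sf sg; under eq_fun do rewrite -mulN1r.
by apply: square_integrableD => //; exact: square_integrableZ.
Qed.

Lemma integrable_sum_EFin (I : Type) (s : seq I) (f : I -> T -> R) :
  (forall i, P.-integrable setT (EFin \o f i)) ->
  P.-integrable setT (EFin \o (fun x => \sum_(i <- s) f i x)).
Proof.
move=> i_f; elim: s => [|i s IH].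
  by apply: eq_integrable (integrable0 P setT) => // x _; rewrite /= big_nil.
apply: eq_integrable (integrableD measurableT (i_f i) IH) => // x _.
by rewrite /= big_cons.
Qed.

Lemma Rintegral_sum (I : Type) (s : seq I) (f : I -> T -> R) :
  (forall i, P.-integrable setT (EFin \o f i)) ->
  \int[P]_x (\sum_(i <- s) f i x) = \sum_(i <- s) \int[P]_x f i x.
Proof.
move=> i_f; elim: s => [|i s IH].
  under eq_Rintegral do rewrite big_nil.
  by rewrite big_nil Rintegral_cst// mul0r.
under eq_Rintegral do rewrite big_cons.
by rewrite RintegralD// ?IH ?big_cons//; exact: integrable_sum_EFin.
Qed.

Lemma Rintegral_bilinear n (A : 'M[R]_n) (f : 'I_n -> T -> R) :
  (forall i, square_integrable (f i)) ->
  P.-integrable setT (EFin \o (fun x => \sum_i \sum_j A i j * (f i x * f j x))) /\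
  \int[P]_x (\sum_i \sum_j A i j * (f i x * f j x)) =
  \sum_i \sum_j A i j * \int[P]_x (f i x * f j x).
Proof.
move=> sf.
have i1 i j : P.-integrable setT (EFin \o (fun x => A i j * (f i x * f j x))).
  exact: (integrableZl measurableT (A i j) (integrable_mul (sf i) (sf j))).
have i2 i : P.-integrable setT
    (EFin \o (fun x => \sum_j A i j * (f i x * f j x))).
  exact: integrable_sum_EFin.
split; first exact: integrable_sum_EFin.
rewrite Rintegral_sum//; apply: eq_bigr => i _.
rewrite Rintegral_sum//; apply: eq_bigr => j _.
by rewrite RintegralZl//; exact: integrable_mul.
Qed.

End square_integrable.

(* With a = |v|^2, b = <u,v>, c = |u|^2: a subgradient of the norm at v <> 0,
   evaluated in the direction u, can only be <u,v> / |v|. *)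
Lemma norm_subgradient_unique (R : realType) (a b c q : R) : 0 < a ->
  0 <= c -> (forall k, 0 <= a + 2 * k * b + k ^+ 2 * c) ->
  (forall k, Num.sqrt a + k * q <= Num.sqrt (a + 2 * k * b + k ^+ 2 * c)) ->
  q = b / Num.sqrt a.
Proof.
move=> a0 c0 pos H; pose s := Num.sqrt a.
have s0 : 0 < s by rewrite sqrtr_gt0.
have s2 : s ^+ 2 = a by rewrite sqr_sqrtr// ltW.
pose C := c / (2 * s); have C0 : 0 <= C by rewrite divr_ge0// mulr_ge0// ltW.
have K k : k * (q - b / s) <= k ^+ 2 * C.
  have := H k; have := pos k; rewrite -/s.
  set x := a + 2 * k * b + k ^+ 2 * c => x0.
  (* The tangent to the square root at [s ^+ 2] lies above it; this leaves a comparison linear in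
     [k] up to a [k ^+ 2] term. *)
  have amgm : Num.sqrt x <= (x / s + s) / 2.
    rewrite ler_pdivlMr// -subr_ge0.
    have -> : x / s + s - Num.sqrt x * 2 = (Num.sqrt x - s) ^+ 2 / s.
      by rewrite -{1}(sqr_sqrtr x0); field; rewrite gt_eqF.
    by rewrite divr_ge0 ?sqr_ge0// ltW.
  have : (x / s + s) / 2 = s + k * (b / s) + k ^+ 2 * C.
    by rewrite /x -s2 /C; field; rewrite gt_eqF.
  by lra.
have C1 : 0 < C + 1 by lra.
(* With this [k], clearing denominators yields [e * (C + 1) <= e * C] for the square [e] of
   [q - b / s], hence [e = 0]. The shift by 1 avoids dividing by [C = 0]. *)
have := K ((q - b / s) / (C + 1)).
rewrite expr_div_n mulrAC -expr2 [X in _ <= X]mulrC.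
set e := (q - b / s) ^+ 2.
have -> : e / (C + 1) = e * (C + 1) / (C + 1) ^+ 2 by field; rewrite gt_eqF.
rewrite mulrA ler_pM2r ?invr_gt0 ?exprn_gt0// => eC.
have e0 : e == 0 by rewrite eq_le sqr_ge0 andbT; lra.
by move: e0; rewrite sqrf_eq0 subr_eq0 => /eqP.
Qed.

(** * Second moments and sign correlations of Gaussian projections *)

Section gaussian_sample.
Context d (T : measurableType d) (R : realType) (P : probability T R) (n : nat).
Variable G : T -> 'cV[R]_n.
Local Open Scope classical_set_scope.
Local Notation gamma := (normal_prob (0 : R) 1).
Hypothesis mG : coord_measurable G.
Hypothesis lawG : forall (h : R -> R) v, continuous h -> (forall x, 0 <= h x) ->
  (\int[P]_x (h (dotc v (G x)))%:E =
   \int[gamma]_t (h (Num.sqrt (dotc v v) * t))%:E)%E.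
Implicit Types u v w : 'cV[R]_n.

(** First absolute moment of a standard Gaussian. *)
Let kappa : R := Num.sqrt (2 / pi).

Let kappa_gt0 : 0 < kappa.
Proof. by rewrite sqrtr_gt0 divr_gt0 ?pi_gt0. Qed.

Lemma expect_sqr_dotc v :
  (\int[P]_x (dotc v (G x) ^+ 2)%:E = (dotc v v)%:E)%E.
Proof.
rewrite (lawG (h := fun t => t ^+ 2));
  [|exact: exprn_continuous|by move=> x; exact: sqr_ge0].
under eq_integral do rewrite exprMn sqr_sqrtr ?dotc_ge0// EFinM.
rewrite ge0_integralZl//.
- by rewrite [X in (_ * X)%E]integral_normal_sqr mule1.
- by apply/measurable_EFinP; exact: measurable_funX.
- by move=> x _; rewrite lee_fin sqr_ge0.
- by rewrite lee_fin dotc_ge0.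
Qed.

Lemma expect_norm_dotc v :
  (\int[P]_x (`|dotc v (G x)|)%:E = (kappa * Num.sqrt (dotc v v))%:E)%E.
Proof.
rewrite (lawG (h := fun t => `|t|)); [|exact: norm_continuous|by []].
under eq_integral do rewrite normrM ger0_norm ?sqrtr_ge0// EFinM.
rewrite ge0_integralZl//.
- by rewrite [X in (_ * X)%E]integral_normal_norm -EFinM mulrC.
- by apply/measurable_EFinP; exact: normr_measurable.
Qed.

Lemma square_integrable_dotc v : square_integrable P (fun x => dotc v (G x)).
Proof.
split; first exact: measurable_dotc.
apply/integrableP; split.
  by apply/measurable_EFinP; apply: measurable_funX; exact: measurable_dotc.
under eq_integral do rewrite gee0_abs ?lee_fin ?sqr_ge0//.
by rewrite expect_sqr_dotc ltry.
Qed.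

(** Polarization: only the laws of single projections are given, so the mixed moment is read off
    from the squares for [u], [v] and [u + v]. *)
Lemma expect_mul_dotc u v :
  \int[P]_x (dotc u (G x) * dotc v (G x)) = dotc u v.
Proof.
have sq w : \int[P]_x (dotc w (G x) ^+ 2) = dotc w w.
  by rewrite /Rintegral expect_sqr_dotc.
have [su sv] := (square_integrable_dotc u, square_integrable_dotc v).
have := sq (u + v).
have -> : \int[P]_x (dotc (u + v) (G x) ^+ 2) = \int[P]_x (dotc u (G x) ^+ 2 +
    dotc v (G x) ^+ 2 + 2 * (dotc u (G x) * dotc v (G x))).
  by apply: eq_Rintegral => x _; rewrite dotcDl; ring.
have iuv := integrable_mul su sv.
rewrite RintegralD//; last 2 first.
- exact: integrableD su.2 sv.2.
- exact: integrableZl iuv.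
rewrite RintegralD ?RintegralZl//; [|exact: su.2|exact: sv.2].
rewrite !sq !dotcDl !dotcDr (dotcC v u); lra.
Qed.

Lemma measurable_sgn1 : measurable_fun setT (@sgn1 R).
Proof.
by apply: measurable_fun_ifT => //; exact: measurable_fun_ler.
Qed.

Lemma normr_sgn1 (t : R) : `|sgn1 t| = 1.
Proof. by rewrite /sgn1; case: ifP => _; rewrite ?normrN normr1. Qed.

Lemma sgn1_sqr (t : R) : sgn1 t * sgn1 t = 1.
Proof. by rewrite /sgn1; case: ifP => _; rewrite ?mulrNN mulr1. Qed.

Lemma sgn1_mul (t : R) : t * sgn1 t = `|t|.
Proof.
by rewrite /sgn1; case: ger0P => _; rewrite ?mulr1 ?mulrN1.
Qed.

Lemma square_integrable_sgn1 v :
  square_integrable P (fun x => sgn1 (dotc v (G x))).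
Proof.
apply: (@square_integrable_bounded _ _ _ _ _ 1) => [|x]; last by rewrite normr_sgn1.
by apply: (measurableT_comp measurable_sgn1); exact: measurable_dotc.
Qed.

(** The joint law of the two projections is never computed: [m / kappa] is a directional subgradient
    of the norm at [v], and [norm_subgradient_unique] determines it. *)
Lemma expect_dotc_sgn1 u v : v != 0 ->
  \int[P]_x (dotc u (G x) * sgn1 (dotc v (G x))) =
  kappa * (dotc u v / Num.sqrt (dotc v v)).
Proof.
move=> v0; set m := LHS.
have mE : m = kappa * (m / kappa) by field; rewrite gt_eqF.
rewrite mE; congr (_ * _).
have E w : \int[P]_x `|dotc w (G x)| = kappa * Num.sqrt (dotc w w).
  by rewrite /Rintegral expect_norm_dotc.
have sqE k : dotc (v + k *: u) (v + k *: u) =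
    dotc v v + 2 * k * dotc u v + k ^+ 2 * dotc u u.
  by rewrite !(dotcDl, dotcDr, dotcZl, dotcZr) (dotcC v u); ring.
have iN w : P.-integrable setT (EFin \o (fun x => `|dotc w (G x)|)).
  under eq_fun do rewrite -sgn1_mul.
  apply: integrable_mul; first exact: square_integrable_dotc.
  exact: square_integrable_sgn1.
have iS := integrable_mul (square_integrable_dotc u) (square_integrable_sgn1 v).
apply: (@norm_subgradient_unique _ (dotc v v) _ (dotc u u)).
- by rewrite lt_def dotc_eq0 v0 dotc_ge0.
- exact: dotc_ge0.
- by move=> k; rewrite -sqE dotc_ge0.
move=> k; rewrite -sqE -(ler_pM2l kappa_gt0) -E mulrDr -E.
have -> : kappa * (k * (m / kappa)) = k * m by field; rewrite gt_eqF.
have ikS := integrableZl measurableT k iS.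
rewrite /m -RintegralZl// -RintegralD//.
apply: le_Rintegral => //; first exact: (integrableD measurableT (iN v) ikS).
(* Pointwise, the projection on [v + k *: u] times the sign of the projection on [v] is at most its
   own absolute value. *)
move=> x _; rewrite dotcDl dotcZl -!sgn1_mul mulrA -mulrDl.
rewrite (le_trans (ler_norm _))// normrM normr_sgn1 mulr1 sgn1_mul//.
Qed.

End gaussian_sample.

(** * Randomized rounding *)

Section rounding.
Context {R : realType}.
Local Open Scope classical_set_scope.

Definition rowv n (S : 'M[R]_n) (i : 'I_n) : 'cV[R]_n := (row i S)^T.

(* Zero rows stay zero, since 0^-1 = 0. *)
Definition unit_rowv n (S : 'M[R]_n) (i : 'I_n) : 'cV[R]_n :=
  (Num.sqrt (dotc (rowv S i) (rowv S i)))^-1 *: rowv S i.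

Lemma dotc_rowv n (S : 'M[R]_n) i g : dotc (rowv S i) g = (S *m g) i 0.
Proof. by rewrite mxE; apply: eq_bigr => j _; rewrite !mxE. Qed.

Lemma borel_round_quad n (C S : 'M[R]_n) :
  borel_fun (fun g => let x := round_vec S g in (x^T *m C *m x) 0 0).
Proof.
move=> d T G mG; under eq_fun do rewrite /= quad_sum.
apply: measurable_sum => i; apply: measurable_sum => j.
have mx k : measurable_fun setT (fun w => round_vec S (G w) k 0).
  rewrite (_ : (fun w => _) = (fun w => sgn1 (dotc (rowv S k) (G w)))).
    by apply: (measurableT_comp (@measurable_sgn1 R)); exact: measurable_dotc.
  by apply/funext => w; rewrite mxE dotc_rowv.
by apply: measurable_funM => //; exact: measurable_funM.
Qed.

Lemma round_quad_bounded n (C S : 'M[R]_n) g :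
  `|(((round_vec S g)^T) *m C *m round_vec S g) 0 0| <= \sum_i \sum_j `|C i j|.
Proof.
rewrite quad_sum (le_trans (ler_norm_sum _ _ _))// ler_sum// => i _.
rewrite (le_trans (ler_norm_sum _ _ _))// ler_sum// => j _.
by rewrite !mxE !normrM !normr_sgn1 !mulr1.
Qed.

Lemma dotc_unit_rowv n (S : 'M[R]_n) i :
  dotc (unit_rowv S i) (unit_rowv S i) = (rowv S i != 0)%:R.
Proof.
rewrite dotcZl dotcZr; set w := rowv S i.
have [->|w0] := eqVneq w 0.
  by rewrite /dotc big1 ?mulr0// => j _; rewrite mxE mul0r.
have w1 : 0 < dotc w w by rewrite lt_def dotc_eq0 w0 dotc_ge0.
rewrite mulrA -expr2 exprVn sqr_sqrtr ?dotc_ge0// mulVf// gt_eqF//.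
Qed.

(* W is the second-moment matrix of the signs, with the (constant) signs of the
   zero rows replaced by 0. *)
Lemma rounding_gram n (S : 'M[R]_n) :
  let U := \matrix_(i, j) dotc (unit_rowv S i) (unit_rowv S j) in
  exists W : 'M[R]_n,
  [/\ psd ((pi / 2) *: W - U), forall i, W i i = (rowv S i != 0)%:R &
    forall (C : 'M[R]_n) e,
    (forall x y : 'cV[R]_n, (forall i, `|x i 0| = 1) ->
      (forall i, y i 0 = (rowv S i != 0)%:R * x i 0) ->
      (y^T *m C *m y) 0 0 - e <= (x^T *m C *m x) 0 0) ->
    \tr (C *m W) - e <= rounding_value C S].
Proof.
move=> U; have [d [T [P [G [mG EG lawG]]]]] := @gauss_expectE R n.
pose c : R := Num.sqrt (pi / 2).
have pi0 : 0 < pi / 2 :> R by rewrite divr_gt0 ?pi_gt0.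
have c0 : 0 < c by rewrite sqrtr_gt0.
have c2 : c ^+ 2 = pi / 2 by rewrite sqr_sqrtr// ltW.
have cV : Num.sqrt (2 / pi) = c^-1 :> R by rewrite -[2 / pi]invf_div sqrtrV ?ltW.
pose z i : R := (rowv S i != 0)%:R.
pose Y i x := dotc (unit_rowv S i) (G x).
(* A zero row is rounded to the constant 1. Masking it by [z i] makes [Es] hold for zero rows too,
   both sides being 0. *)
pose s i x := z i * sgn1 (dotc (rowv S i) (G x)).
pose f i x := Y i x - c * s i x.
have sY i : square_integrable P (Y i) by exact: square_integrable_dotc.
have ss i : square_integrable P (s i).
  by apply: square_integrableZ; exact: square_integrable_sgn1.
have sf i : square_integrable P (f i).
  by apply: square_integrableB => //; exact: square_integrableZ.
have EY i j : \int[P]_x (Y i x * Y j x) = U i j.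
  by rewrite (expect_mul_dotc mG lawG) mxE.
have Es i j : \int[P]_x (Y i x * s j x) = c^-1 * U i j.
  rewrite mxE; have [wj|wj] := eqVneq (rowv S j) 0.
    rewrite /unit_rowv wj scaler0 dotcC [dotc 0 _]big1 ?mulr0; last first.
      by move=> k _; rewrite mxE mul0r.
    under eq_Rintegral do rewrite /s /z wj eqxx mul0r mulr0.
    by rewrite Rintegral_cst// mul0r.
  under eq_Rintegral do rewrite /s /z wj mul1r.
  rewrite (expect_dotc_sgn1 mG lawG)// cV; congr (_ * _).
  by rewrite [unit_rowv S j]/unit_rowv dotcZr mulrC.
pose W : 'M[R]_n := \matrix_(i, j) \int[P]_x (s i x * s j x).
(* Rietz's identity: each of the two cross terms contributes [- U i j], so the total is
   [U + c ^+ 2 *: W] minus twice [U]. *)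
have Ef i j : \int[P]_x (f i x * f j x) = ((pi / 2) *: W - U) i j.
  have -> : \int[P]_x (f i x * f j x) = \int[P]_x ((Y i x * Y j x +
      c ^+ 2 * (s i x * s j x)) - (c * (Y i x * s j x) + c * (Y j x * s i x))).
    by apply: eq_Rintegral => x _; rewrite /f; ring.
  have i1 := integrable_mul (sY i) (sY j).
  have i2 := integrable_mul (ss i) (ss j).
  have i3 := integrable_mul (sY i) (ss j).
  have i4 := integrable_mul (sY j) (ss i).
  have i2' := integrableZl measurableT (c ^+ 2) i2.
  have i3' := integrableZl measurableT c i3.
  have i4' := integrableZl measurableT c i4.
  rewrite RintegralB//; last 2 first.
  - exact: (integrableD measurableT i1 i2').
  - exact: (integrableD measurableT i3' i4').
  rewrite !RintegralD// !RintegralZl// EY !Es.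
  have -> : U j i = U i j by rewrite !mxE dotcC.
  by rewrite !mxE c2; field; rewrite gt_eqF.
exists W; split.
- split.
    apply/matrixP => i j; rewrite !mxE dotcC; congr (_ * _ - _).
    by apply: eq_Rintegral => x _; rewrite mulrC.
  move=> v; rewrite quad_sum.
  (* With these weights the quadratic form at [v] is the expectation of the square of a linear
     combination of the [f i]. *)
  pose A : 'M[R]_n := \matrix_(i, j) (v i 0 * v j 0).
  have [_ EA] := Rintegral_bilinear A sf.
  have -> : \sum_i \sum_j ((pi / 2) *: W - U) i j * (v i 0 * v j 0) =
      \int[P]_x (\sum_i \sum_j A i j * (f i x * f j x)).
    rewrite EA; apply: eq_bigr => i _; apply: eq_bigr => j _.
    by rewrite Ef mulrC [A i j]mxE.
  apply: Rintegral_ge0 => x _.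
  have -> : \sum_i \sum_j A i j * (f i x * f j x) = (\sum_i v i 0 * f i x) ^+ 2.
    rewrite expr2 mulr_suml; apply: eq_bigr => i _.
    by rewrite mulr_sumr; apply: eq_bigr => j _; rewrite mxE; ring.
  exact: sqr_ge0.
- move=> i; rewrite mxE.
  under eq_Rintegral do rewrite /s mulrACA sgn1_sqr mulr1.
  rewrite Rintegral_cst// [X in fine X]probability_setT mulr1 /z.
  by case: eqP; rewrite ?mul0r ?mulr1.
- move=> C e Ce; rewrite /rounding_value.
  rewrite (EG _ _ (@borel_round_quad n C S) (round_quad_bounded C S)).
  have [iC EC] := Rintegral_bilinear C ss.
  have -> : \tr (C *m W) = \int[P]_x (\sum_i \sum_j C i j * (s i x * s j x)).
    rewrite EC; apply: eq_bigr => i _; rewrite mxE; apply: eq_bigr => j _.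
    rewrite mxE; congr (_ * _).
    by apply: eq_Rintegral => x _; rewrite mulrC.
  have -> : e = \int[P]_x e.
    by rewrite Rintegral_cst// [X in fine X]probability_setT mulr1.
  have ie : P.-integrable setT (EFin \o (fun=> e)).
    by apply: finite_measure_integrable_cst.
  rewrite -RintegralB//; apply: le_Rintegral => //.
  + exact: (integrableB measurableT iC ie).
  + apply: (@bounded_integrable_probability _ _ _ _ _ (\sum_i \sum_j `|C i j|)).
      exact: (@borel_round_quad n C S _ _ _ mG).
    by move=> x; exact: round_quad_bounded.
  + move=> x _ /=.
    (* The hypothesis on [e] is used sample by sample, with the masked sign vector as [y]. *)
    have := Ce (round_vec S (G x)) (\col_i s i x); rewrite quad_sum.
    have -> : \sum_i \sum_j C i j * ((\col_k s k x) i 0 * (\col_k s k x) j 0) =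
        \sum_i \sum_j C i j * (s i x * s j x).
      by apply: eq_bigr => i _; apply: eq_bigr => j _; rewrite !mxE.
    apply => i; rewrite !mxE; first exact: normr_sgn1.
    by rewrite /s dotc_rowv mxE.
Qed.

End rounding.

(** * Symmetric matrices and the semidefinite program *)

Section symmetric_matrices.
Context {R : realType}.

(** For [w = M *m v], the form at [v + t *: w] has no constant term, so its linear coefficient,
    twice the squared norm of [w], must vanish. *)
Lemma psd_isotropic n (M : 'M[R]_n) v : psd M -> dotc v (M *m v) = 0 ->
  M *m v = 0.
Proof.
move=> [Ms Mp] v0; apply/eqP; rewrite -dotc_eq0; apply/eqP.
set w := M *m v.
have K t : 0 <= 2 * t * dotc w w + t ^+ 2 * dotc w (M *m w).
  have := Mp (v + t *: w); rewrite quad_dotc mulmxDr -scalemxAr.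
  rewrite !(dotcDl, dotcDr, dotcZl, dotcZr) v0 add0r.
  have -> : dotc v (M *m w) = dotc w w by rewrite dotc_mulmx Ms.
  rewrite -/w => /le_trans; apply; rewrite le_eqVlt; apply/orP; left.
  by apply/eqP; ring.
have w0 := dotc_ge0 w.
have := Mp w; rewrite quad_dotc; set e := dotc w _ => e0.
have e1 : 0 < e + 1 by lra.
(* A near-minimizer of the quadratic in [t]; using [e + 1] covers [e = 0]. *)
have := K (- (dotc w w / (e + 1))).
move: (dotc w w) w0 => a a0.
have -> : 2 * (- (a / (e + 1))) * a + (- (a / (e + 1))) ^+ 2 * e =
   - (a ^+ 2 * (e + 2) / (e + 1) ^+ 2) by rewrite -/e; field; rewrite gt_eqF.
rewrite oppr_ge0 pmulr_lle0 ?invr_gt0 ?exprn_gt0// pmulr_lle0; last lra.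
move=> a2; apply/eqP; rewrite -sqrf_eq0 eq_le a2 sqr_ge0//.
Qed.

Local Open Scope classical_set_scope.

Lemma dotc_tr_continuous n (A : 'M[R]_n) :
  continuous (fun v : 'rV[R]_n => dotc v^T (A *m v^T)).
Proof.
rewrite (_ : (fun v => _) = (fun v : 'rV[R]_n =>
    \sum_i \sum_j A i j * (v 0 i * v 0 j))); last first.
  by apply/funext => v; rewrite -quad_dotc quad_sum; apply: eq_bigr => i _;
     apply: eq_bigr => j _; rewrite !mxE.
pose add_cont := @add_continuous R.
have cij i j : continuous (fun v : 'rV[R]_n => A i j * (v 0 i * v 0 j)).
  move=> v; apply: (@continuousM R _ (fun=> A i j) (fun v : 'rV[R]_n => v 0 i * v 0 j) v).
    exact: cst_continuous.
  apply: (@continuousM R _ (fun v : 'rV[R]_n => v 0 i) (fun v : 'rV[R]_n => v 0 j) v);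
    exact: coord_continuous.
exact: (continuous_big add_cont (fun i _ =>
  continuous_big add_cont (fun j _ => cij i j))).
Qed.

(** The unit sphere is a closed subset of a box, hence compact, and it is nonempty in positive
    dimension; homogeneity extends the maximum to all vectors. *)
Lemma rayleigh_attained n (A : 'M[R]_n.+1) :
  exists2 v : 'cV[R]_n.+1, dotc v v = 1 &
    forall y, dotc y (A *m y) <= dotc v (A *m v) * dotc y y.
Proof.
pose K := [set v : 'rV[R]_n.+1 | dotc v^T v^T = 1].
have Kn : K !=set0.
  exists (delta_mx 0 0); rewrite /K /= /dotc (bigD1 0)//= big1 ?addr0 => [|i i0].
    by rewrite !mxE !eqxx mulr1.
  by rewrite !mxE (negbTE i0) andbF mul0r.
have cK : compact K.
  apply: (subclosed_compact _ (@rV_compact _ _ (fun=> `[-1 : R, 1]) _)).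
  - have /continuous_closedP := @dotc_tr_continuous _ (1%:M : 'M[R]_n.+1).
    move=> /(_ [set 1]); rewrite (_ : _ @^-1` _ = K); first by apply; exact: closed_eq.
    by apply/seteqP; split=> v; rewrite /K/= mul1mx.
  - by move=> _; exact: segment_compact.
  - move=> v vK i; rewrite /= in_itv/= -ler_norml -(@ler_pXn2r _ 2)//.
      rewrite expr1n -[X in _ <= X]vK real_normK ?num_real//.
      rewrite /dotc (bigD1 i)//= !mxE -expr2 lerDl.
      by apply: sumr_ge0 => j _; rewrite -expr2 sqr_ge0.
    by rewrite nnegrE.
have [v] := compact_EVT_max Kn cK
  (@continuous_subspaceT _ _ K _ (@dotc_tr_continuous _ A)).
rewrite inE => vK vmax; exists v^T => // y.
have [->|y0] := eqVneq y 0; first by rewrite !dotc0l mulr0.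
have y1 : 0 < dotc y y by rewrite lt_def dotc_eq0 y0 dotc_ge0.
pose s := (Num.sqrt (dotc y y))^-1.
have s2 : s * s = (dotc y y)^-1 by rewrite -expr2 exprVn sqr_sqrtr// ltW.
have := vmax (s *: y^T).
rewrite inE /K/= linearZ/= trmxK -scalemxAr !(dotcZl, dotcZr) !mulrA s2.
by rewrite mulVf ?gt_eqF// => /(_ erefl); rewrite mulrC ler_pdivrMr.
Qed.

(** If [l] is the maximal Rayleigh quotient, attained at [v], then [l%:M - A] is positive
    semidefinite and its form vanishes at [v]. By [psd_isotropic], [v] is an eigenvector for [l],
    whence [l <= a]. *)
Lemma symmetric_eigenvalue_ub n (A : 'M[R]_n) a : A^T = A ->
  (forall b, eigenvalue A b -> b <= a) ->
  forall y, dotc y (A *m y) <= a * dotc y y.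
Proof.
case: n A => [A _ _ y|n A As Aa y].
  by rewrite /dotc !big_ord0 mulr0.
have [v v1 vmax] := rayleigh_attained A.
set l := dotc v (A *m v) in vmax.
apply: (le_trans (vmax y)); rewrite ler_wpM2r ?dotc_ge0//; apply: Aa.
have lM : psd (l%:M - A).
  split; first by rewrite linearB/= tr_scalar_mx As.
  move=> z; rewrite quad_dotc mulmxBl mul_scalar_mx dotcDr dotcZr.
  by rewrite -scaleN1r dotcZr mulN1r subr_ge0.
have /(psd_isotropic lM) : dotc v ((l%:M - A) *m v) = 0.
  rewrite mulmxBl mul_scalar_mx dotcDr dotcZr v1 -scaleN1r dotcZr -/l; ring.
rewrite mulmxBl mul_scalar_mx => /eqP; rewrite subr_eq0 => /eqP lv.
apply/eigenvalueP; exists v^T.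
  by rewrite -[A in LHS]As -trmx_mul -lv linearZ.
by rewrite trmx_eq0 -dotc_eq0 v1 oner_eq0.
Qed.

Lemma largest_singular_value_le1 n (C : 'M[R]_n) :
  largest_singular_value C 1 -> forall y, dotc (C *m y) (C *m y) <= dotc y y.
Proof.
move=> [_ [_ H]] y; rewrite -[leRHS]mul1r dotc_mulmx mulmxA dotcC.
apply: symmetric_eigenvalue_ub; first by rewrite trmx_mul trmxK.
by move=> b /H; rewrite expr1n.
Qed.

(** By symmetry the two forms differ by the inner product of [a - b] and [C *m (a + b)]; a weighted
    AM-GM inequality and contractivity of [C] bound it. It serves both the normalization of rows and
    the masking of zero rows. *)
Lemma quad_diff_ge n (C : 'M[R]_n) (del : R) : C^T = C -> 0 < del ->
  (forall y, dotc (C *m y) (C *m y) <= dotc y y) ->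
  forall a b, dotc b (C *m b) -
    (del^-1 * dotc (a - b) (a - b) + del * dotc (a + b) (a + b)) / 2
    <= dotc a (C *m a).
Proof.
move=> Cs del0 Cop a b.
set p := a - b; set q := a + b; set r := C *m q.
have E : dotc a (C *m a) - dotc b (C *m b) = dotc p r.
  rewrite /p /r /q mulmxDr !(dotcDl, dotcDr) -(scaleN1r b) !dotcZl.
  have -> : dotc b (C *m a) = dotc a (C *m b) by rewrite dotc_mulmx Cs dotcC.
  ring.
have rq : dotc r r <= dotc q q by exact: Cop.
clearbody r q p.
(* Dividing this square by [del] is the weighted AM-GM inequality. *)
have := dotc_ge0 (p + del *: r); rewrite !(dotcDl, dotcDr, dotcZl, dotcZr).
rewrite (dotcC r p) => pr.
have : del^-1 * (dotc p p + del * dotc p r + (del * dotc p r + del * (del * dotc r r)))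
   = del^-1 * dotc p p + 2 * dotc p r + del * dotc r r by field; rewrite gt_eqF.
have : 0 <= del^-1 * (dotc p p + del * dotc p r + (del * dotc p r + del * (del * dotc r r))).
  by rewrite pmulr_rge0 ?invr_gt0//; lra.
have : del * dotc r r <= del * dotc q q by rewrite ler_pM2l.
lra.
Qed.

End symmetric_matrices.

(** * Feasible points, perturbation of the objective, and the rounding bound *)

Section semidefinite_program.
Context {R : realType}.

Lemma psdD n (A B : 'M[R]_n) : psd A -> psd B -> psd (A + B).
Proof.
move=> [As Ap] [Bs Bp]; split=> [|v]; first by rewrite linearD/= As Bs.
by rewrite mulmxDr mulmxDl mxE addr_ge0.
Qed.

Lemma psdZ n (a : R) (A : 'M[R]_n) : 0 <= a -> psd A -> psd (a *: A).
Proof.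
move=> a0 [As Ap]; split=> [|v]; first by rewrite linearZ/= As.
by rewrite -scalemxAr -scalemxAl mxE mulr_ge0.
Qed.

Lemma psd_congruence n (A J : 'M[R]_n) : psd A -> psd (J^T *m A *m J).
Proof.
move=> [As Ap]; split=> [|v]; first by rewrite !trmx_mul trmxK As mulmxA.
by have := Ap (J *m v); rewrite trmx_mul !mulmxA.
Qed.

Lemma psd_diag n (d : 'rV[R]_n) : (forall i, 0 <= d 0 i) -> psd (diag_mx d).
Proof.
move=> d0; split=> [|v]; first by rewrite tr_diag_mx.
rewrite quad_dotc; apply: sumr_ge0 => i _; rewrite mul_diag_mx mxE mulrCA.
by rewrite mulr_ge0// -expr2 sqr_ge0.
Qed.

(** Completing the diagonal of [F], flipping the signs of one block and rescaling gives a feasible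
    point whose objective is a negative multiple of that of [F]; optimality of [rhostar] then bounds
    [F] from below. *)
Lemma bipartite_psd_trace_ge (m : nat) (B : 'M[R]_m) (rhostar F : 'M[R]_(m + m))
    (z : 'I_(m + m) -> bool) (al : R) :
  let n := (m + m)%N in
  let C : 'M[R]_(m + m) := block_mx 0 B B^T 0 in
  (0 < n)%N -> 0 < al -> sdp_optimal C rhostar -> psd F ->
  (forall i, F i i = al * (z i)%:R) ->
  - (al * n%:R * \tr (C *m rhostar)) <= \tr (C *m F).
Proof.
move=> n C n0 al0 [_ opt] pF dF.
(* Fills the vanishing diagonal entries of [F] up to [al], at no cost since [C] has zero
   diagonal. *)
pose D : 'M[R]_n := diag_mx (\row_i (al * (~~ z i)%:R)).
pose d : 'rV[R]_n := row_mx (const_mx 1) (const_mx (-1)).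
pose J := diag_mx d.
have Js : J^T = J by rewrite tr_diag_mx.
have n0' : 0 < n%:R :> R by rewrite ltr0n.
pose rho := (al * n%:R)^-1 *: (J^T *m (F + D) *m J).
have dd i : d 0 i * d 0 i = 1.
  by rewrite !mxE; case: splitP => j _; rewrite !mxE ?mulrNN mulr1.
have JCJ : J *m C *m J^T = - C.
  rewrite Js /J /d diag_mx_row !diag_const_mx /C !mulmx_block.
  rewrite !(mul0mx, mulmx0, addr0, add0r) !(mul_scalar_mx, mul_mx_scalar) !scale1r.
  by rewrite !scaleN1r opp_block_mx !oppr0.
have trCD : \tr (C *m D) = 0.
  rewrite /mxtrace big1// => i _; rewrite mul_mx_diag mxE.
  suff -> : C i i = 0 by rewrite mul0r.
  by rewrite !mxE; case: split_ordP => j ij; rewrite !mxE; case: split_ordP => k ik;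
    rewrite ?mxE//; move/eqP: ij; rewrite ik ?eq_lrshift ?eq_rlshift.
have trC : \tr (C *m rho) = - ((al * n%:R)^-1 * \tr (C *m F)).
  rewrite -scalemxAr mxtraceZ -mulrN; congr (_ * _).
  rewrite !mulmxA mxtrace_mulC !mulmxA JCJ mulNmx mulmxDr linearN/= linearD/=.
  by rewrite trCD addr0.
have frho : sdp_feasible rho.
  split.
    apply: psdZ; first by rewrite invr_ge0 mulr_ge0 ?ltW.
    apply: psd_congruence; apply: psdD => //; apply: psd_diag => i.
    by rewrite mxE mulr_ge0// ltW.
  move=> i; rewrite mxE Js /J mul_mx_diag mxE mul_diag_mx mxE mulrAC dd mul1r.
  rewrite !mxE dF eqxx mulr1n -mulrDr -natrD addnC addn_negb mulr1.
  by rewrite invfM mulrAC mulVf ?mul1r// gt_eqF.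
have := opt rho frho; rewrite trC lerNl ler_pdivlMl ?mulr_gt0// => h.
by rewrite -mulrN.
Qed.

(** Lets [quad_diff_ge] be applied column by column. *)
Lemma trace_gram n (C M : 'M[R]_n) :
  \tr (C *m (M *m M^T)) = \sum_k dotc (col k M) (C *m col k M).
Proof.
rewrite mulmxA /mxtrace.
under eq_bigr do rewrite mxE.
rewrite exchange_big/=; apply: eq_bigr => k _; apply: eq_bigr => i _.
rewrite !mxE mulrC; congr (_ * _).
by apply: eq_bigr => j _; rewrite !mxE.
Qed.

(* t is the factor normalizing a row of norm r; the case r = 0 is covered by
   0^-1 = 0. *)
Lemma row_norm_bounds (nu r t : R) : 0 <= r -> 0 < nu -> t = r^-1 ->
  (t - Num.sqrt nu) ^+ 2 * r ^+ 2 <= `|nu * r ^+ 2 - 1| /\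
  (t + Num.sqrt nu) ^+ 2 * r ^+ 2 <= 4 + 2 * `|nu * r ^+ 2 - 1|.
Proof.
move=> r0 nu0 ->; have [->|rN0] := eqVneq r 0.
  by rewrite expr0n/= !mulr0 addr_ge0// mulr_ge0.
set q := Num.sqrt nu; have q0 : 0 < q by rewrite sqrtr_gt0.
have q2 : nu = q ^+ 2 by rewrite sqr_sqrtr// ltW.
have qr0 : 0 <= q * r by rewrite mulr_ge0// ltW.
have -> : (r^-1 - q) ^+ 2 * r ^+ 2 = (q * r - 1) ^+ 2 by field.
have -> : (r^-1 + q) ^+ 2 * r ^+ 2 = (q * r + 1) ^+ 2 by field.
have -> : nu * r ^+ 2 - 1 = (q * r - 1) * (q * r + 1) by rewrite q2; ring.
(* The first bound is [|p - 1| <= p + 1], the second [(p + 1) ^+ 2 <= 2 * p ^+ 2 + 2]. *)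
move: (q * r) qr0 => p p0; split.
  rewrite normrM -[X in X <= _]real_normK ?num_real// expr2 ler_wpM2l//.
  by rewrite [leRHS]ger0_norm ?addr_ge0// ler_norml; apply/andP; split; lra.
have := ler_norm ((p - 1) * (p + 1)); nra.
Qed.

(** Both sides are the squared Frobenius norm; this passes from columnwise perturbation to rowwise
    normalization. *)
Lemma dotc_sum_col n (A : 'M[R]_n) :
  \sum_k dotc (col k A) (col k A) = \sum_i dotc (rowv A i) (rowv A i).
Proof.
rewrite exchange_big/=; apply: eq_bigr => i _; apply: eq_bigr => k _.
by rewrite !mxE.
Qed.

(** Strictness, from [cos 1 > 0], makes the scale [pi / 2 - 1] of the Gram matrix positive. *)
Lemma pi_gt2 : 2 < pi :> R.
Proof.
rewrite lt_neqAle pi_ge2 andbT; apply/eqP => pi2.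
by have := @cos1_gt0 R; rewrite -(divff (x := 2 : R))// [X in X / _]pi2 cos_pihalf ltxx.
Qed.

Lemma dotc_rowv_self n (S : 'M[R]_n) i : S^T = S ->
  dotc (rowv S i) (rowv S i) = (S *m S) i i.
Proof.
move=> Ss; rewrite dotc_rowv !mxE; apply: eq_bigr => k _; rewrite !mxE.
by congr (_ * _); rewrite -[in LHS]Ss mxE.
Qed.

Lemma diagonal_deviation n (rho : 'M[R]_n) (eps : R) : (0 < n)%N ->
  \sum_i `|rho i i - n%:R^-1| <= eps ->
  \sum_i `|n%:R * rho i i - 1| <= n%:R * eps.
Proof.
rewrite -(ltr0n R) => n0 trho.
apply: le_trans (ler_wpM2l (ltW n0) trho); rewrite mulr_sumr.
apply: ler_sum => i _; rewrite -{2}(ger0_norm (ltW n0)) -normrM mulrBr.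
by rewrite mulfV// gt_eqF.
Qed.

(** Compares the columns of the row-normalized matrix [V] with those of [M], which is [S] scaled by
    the root of [n], using [quad_diff_ge]; [row_norm_bounds] controls [V - M] and [V + M]. *)
Lemma normalized_gram_trace_ge n (C rho S : 'M[R]_n) (eps del : R) :
  (0 < n)%N -> C^T = C -> (forall y, dotc (C *m y) (C *m y) <= dotc y y) ->
  \sum_i `|rho i i - n%:R^-1| <= eps -> 0 < del -> eps <= del ^+ 2 -> eps <= 2^-1 ->
  S^T = S -> S *m S = rho ->
  n%:R * \tr (C *m rho) - 3 * n%:R * del <=
  \tr (C *m \matrix_(i, j) dotc (unit_rowv S i) (unit_rowv S j)).
Proof.
move=> n0 Cs Cop trho del0 epsdel eps2 Ss SS.
have n0' : 0 < n%:R :> R by rewrite ltr0n.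
pose V : 'M[R]_n := \matrix_(i, j) unit_rowv S i j 0.
pose M : 'M[R]_n := Num.sqrt n%:R *: S.
have -> : \matrix_(i, j) dotc (unit_rowv S i) (unit_rowv S j) = V *m V^T.
  by apply/matrixP => i j; rewrite !mxE; apply: eq_bigr => k _; rewrite !mxE.
have -> : n%:R * \tr (C *m rho) = \tr (C *m (M *m M^T)).
  rewrite /M linearZ/= Ss -scalemxAr -scalemxAl scalerA -scalemxAr mxtraceZ SS.
  by rewrite -expr2 sqr_sqrtr// ltW.
rewrite !trace_gram.
have rhoE i : dotc (rowv S i) (rowv S i) = rho i i by rewrite -SS dotc_rowv_self.
have dev := diagonal_deviation n0 trho.
have bounds i := @row_norm_bounds n%:R _ _ (sqrtr_ge0 (dotc (rowv S i) (rowv S i)))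
  n0' erefl.
have rowB i : dotc (rowv (V - M) i) (rowv (V - M) i) <= `|n%:R * rho i i - 1|.
  have := (bounds i).1; rewrite sqr_sqrtr ?dotc_ge0// rhoE; apply: le_trans.
  rewrite -rhoE le_eqVlt; apply/orP; left; apply/eqP.
  rewrite expr2 -!mulrA -dotcZr -dotcZl; congr dotc; apply/colP => j;
  by rewrite !mxE mulrBl.
have rowD i : dotc (rowv (V + M) i) (rowv (V + M) i) <= 4 + 2 * `|n%:R * rho i i - 1|.
  have := (bounds i).2; rewrite sqr_sqrtr ?dotc_ge0// rhoE; apply: le_trans.
  rewrite -rhoE le_eqVlt; apply/orP; left; apply/eqP.
  rewrite expr2 -!mulrA -dotcZr -dotcZl; congr dotc; apply/colP => j;
  by rewrite !mxE mulrDl.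
have sB : \sum_k dotc (col k (V - M)) (col k (V - M)) <= n%:R * eps.
  rewrite dotc_sum_col; apply: le_trans dev; exact: ler_sum.
have sD : \sum_k dotc (col k (V + M)) (col k (V + M)) <= 5 * n%:R.
  rewrite dotc_sum_col; apply: (@le_trans _ _ (\sum_i (4 + 2 * `|n%:R * rho i i - 1|))).
    exact: ler_sum.
  rewrite big_split/= sumr_const card_ord -mulr_sumr -[4 *+ n]mulr_natr.
  have : n%:R * eps <= n%:R * 2^-1 by rewrite ler_pM2l.
  lra.
have := @ler_sum R 'I_n (index_enum 'I_n) xpredT _ _
  (fun k _ => quad_diff_ge Cs del0 Cop (col k V) (col k M)).
rewrite sumrB -mulr_suml big_split/= -!mulr_sumr.
under [X in del^-1 * X]eq_bigr => k _.
  rewrite (_ : col k V - col k M = col k (V - M)); last by apply/colP => i; rewrite !mxE.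
  over.
under [X in del * X]eq_bigr => k _.
  rewrite (_ : col k V + col k M = col k (V + M)); last by apply/colP => i; rewrite !mxE.
  over.
apply: le_trans; rewrite lerD2l lerN2.
(* Since [eps <= del ^+ 2], the two terms are at most [n * del] and [5 * n * del]; half their sum
   gives the constant 3. *)
have : del^-1 * \sum_k dotc (col k (V - M)) (col k (V - M)) <= n%:R * del.
  rewrite ler_pdivrMl// (le_trans sB)// mulrCA -expr2 ler_pM2l//.
have : del * \sum_k dotc (col k (V + M)) (col k (V + M)) <= del * (5 * n%:R).
  by rewrite ler_pM2l.
lra.
Qed.

Lemma rounding_value_ge (m : nat) (B : 'M[R]_m) (rhostar rho S : 'M[R]_(m + m))
    (eps del : R) :
  let n := (m + m)%N in
  let C : 'M[R]_(m + m) := block_mx 0 B B^T 0 in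
  largest_singular_value C 1 ->
  sdp_optimal C rhostar ->
  \tr (C *m rhostar) - \tr (C *m rho) <= eps ->
  \sum_(i < m + m) `| rho i i - (n%:R)^-1 | <= eps ->
  eps <= 2^-1 -> 0 < del -> eps <= del -> eps <= del ^+ 2 ->
  psd S -> S *m S = rho ->
  (4 / pi - 1) * n%:R * \tr (C *m rhostar) - 7 * n%:R * del <= rounding_value C S.
Proof.
move=> n C svC opt gap trho eps2 del0 epsdel epsdel2 [Ss _] SS.
(* A singular value comes with a nonzero eigenvector, which excludes dimension 0. *)
have n0 : (0 < n)%N.
  case: svC => _ [/eigenvalueP [v _ v0] _]; rewrite lt0n; apply/eqP => nE.
  move: v v0; rewrite -/n nE => v; by rewrite thinmx0 eqxx.
have n0' : 0 < n%:R :> R by rewrite ltr0n.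
have Cs : C^T = C by rewrite /C tr_block_mx !trmx0 trmxK.
have Cop := largest_singular_value_le1 svC.
have rhoE i : dotc (rowv S i) (rowv S i) = rho i i by rewrite -SS dotc_rowv_self.
have dev := diagonal_deviation n0 trho.
have [W [pF dW]] := rounding_gram S.
set U := (X in psd (_ - X)) in pF.
(* Masking costs half of [n * del + 4 * n * del]. *)
move=> /(_ C (5 / 2 * n%:R * del)) rnd.
have {}rnd : \tr (C *m W) - 5 / 2 * n%:R * del <= rounding_value C S.
  apply: rnd => x y x1 yE; rewrite !quad_dotc.
  apply: le_trans (quad_diff_ge Cs del0 Cop x y); rewrite lerD2l lerN2.
  have xx i : x i 0 * x i 0 = 1.
    by rewrite -expr2 -[x i 0 ^+ 2]real_normK ?num_real// x1 expr1n.
  (* Each zero row has [rho i i = 0] and so deviation 1; hence there are at most [n * eps] of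
     them. *)
  have sB : dotc (x - y) (x - y) <= n%:R * eps.
    apply: le_trans dev; apply: ler_sum => i _; rewrite !mxE yE.
    have [w0|_] := eqVneq (rowv S i) 0; last by rewrite mul1r subrr mul0r.
    have -> : rho i i = 0 by rewrite -rhoE w0 dotc0l.
    by rewrite mul0r subr0 xx mulr0 sub0r normrN normr1.
  have sD : dotc (x + y) (x + y) <= 4 * n%:R.
    rewrite [X in _ <= X]mulr_natr -[n in X in _ <= X]card_ord -sumr_const.
    apply: ler_sum => i _; rewrite !mxE yE.
    by case: (_ != _); rewrite ?(mul1r, mul0r, addr0) ?mulrDl ?mulrDr ?xx; lra.
  have : del^-1 * dotc (x - y) (x - y) <= n%:R * del.
    by rewrite ler_pdivrMl// (le_trans sB)// mulrCA -expr2 ler_pM2l//.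
  have : del * dotc (x + y) (x + y) <= del * (4 * n%:R) by rewrite ler_pM2l.
  lra.
have pi2 : 2 < pi :> R := pi_gt2.
have al0 : 0 < pi / 2 - 1 :> R by lra.
have trU := normalized_gram_trace_ge n0 Cs Cop trho del0 epsdel2 eps2 Ss SS.
have dF i : ((pi / 2) *: W - U) i i = (pi / 2 - 1) * (rowv S i != 0)%:R.
  by rewrite !mxE dW dotc_unit_rowv mulrBl mul1r.
have trF := bipartite_psd_trace_ge n0 al0 opt pF dF.
rewrite -/C -/n mulmxBr linearB/= -scalemxAr mxtraceZ in trF.
rewrite -/U in trU.
have gap' : n%:R * (\tr (C *m rhostar) - \tr (C *m rho)) <= n%:R * del.
  by rewrite ler_pM2l// (le_trans gap).
apply: le_trans rnd.
move: (\tr (C *m W)) (\tr (C *m U)) trF trU => w u trF trU.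
move: (\tr (C *m rhostar)) (\tr (C *m rho)) gap' trF trU => t r gap' trF trU.
have nd : 0 < n%:R * del by rewrite mulr_gt0.
(* The loss 4 is 3 from normalization plus 1 from suboptimality. Dividing by [pi / 2] keeps it below
   4, and with 5/2 from masking the total stays below 7. *)
have h : (2 - pi / 2) * (n%:R * t) - 4 * (n%:R * del) <= pi / 2 * w by lra.
have p0 : 0 < pi / 2 :> R by lra.
have E : (4 / pi - 1) * n%:R * t - 8 / pi * (n%:R * del) =
    (pi / 2)^-1 * ((2 - pi / 2) * (n%:R * t) - 4 * (n%:R * del)).
  by move: (pi : R) p0 => p p0; field; lra.
have : (4 / pi - 1) * n%:R * t - 8 / pi * (n%:R * del) <= w.
  by rewrite E ler_pdivrMl.
have : 8 / pi * (n%:R * del) <= 4 * (n%:R * del).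
  by rewrite ler_pM2r// ler_pdivrMr ?pi_gt0//; lra.
lra.
Qed.

End semidefinite_program.

Theorem theorem4 (R : realType) :
  exists K : R,
  forall (m : nat) (B : 'M[R]_m) (rhostar rho S : 'M[R]_(m + m)) (eps : R),
    let n := (m + m)%N in
    let C : 'M[R]_(m + m) := block_mx 0 B B^T 0 in
    largest_singular_value C 1 ->
    sdp_optimal C rhostar ->
    psd rho ->
    \tr (C *m rhostar) - \tr (C *m rho) <= eps ->
    \sum_(i < m + m) `| rho i i - (n%:R)^-1 | <= eps ->
    0 <= eps -> eps <= 2^-1 ->
    psd S -> S *m S = rho ->
    rounding_value C S >=
      (4 / pi - 1) * n%:R * \tr (C *m rhostar) - K * n%:R * powR eps (3^-1).
Proof.
exists 7 => m B rhostar rho S eps n C svC opt _ gap trho eps0 eps2 pS SS.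
have bound del (d0 : 0 < del) (d1 : eps <= del) (d2 : eps <= del ^+ 2) :=
  rounding_value_ge svC opt gap trho eps2 d0 d1 d2 pS SS.
set x := powR eps 3^-1.
(* For [eps = 0] the choice [del = x] is not positive; instead [del] is taken arbitrarily small. *)
have [e0|eN0] := eqVneq eps 0.
  rewrite /x e0 powR0 ?invr_eq0// mulr0 subr0.
  apply/ler_addgt0Pr => e e_gt0.
  have n1 : 0 < 7 * n%:R + 1 :> R by rewrite ltr_wpDl// mulr_ge0.
  pose del := e / (7 * n%:R + 1).
  have del0 : 0 < del by rewrite divr_gt0.
  have delE : 7 * n%:R * del = e - del by rewrite /del; field; rewrite gt_eqF.
  have := bound del del0; rewrite e0 (ltW del0) sqr_ge0 delE => /(_ isT isT).
  by rewrite lerBlDr => /le_trans; apply; rewrite lerD2l; lra.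
have x0 : 0 < x by rewrite powR_gt0// lt_def eN0.
have x3 : x ^+ 3 = eps by rewrite -powR_mulrn ?powR_ge0// -powRrM mulVf// powRr1.
have x1 : x <= 1.
  rewrite leNgt; apply/negP => x_gt1.
  by have := exprn_egt1 3 x_gt1; rewrite x3/=; lra.
have x2 : x ^+ 2 <= x by rewrite expr2 ler_piMr// ltW.
(* As [x <= 1], the chain [x ^+ 3 <= x ^+ 2 <= x] makes [del = x] admissible. *)
have xx : eps <= x ^+ 2 by rewrite -x3 exprS ler_piMl// sqr_ge0.
exact: bound x0 (le_trans xx x2) xx.
Qed.
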